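(* Let $G$ be a finite acyclic directed graph. If the independence poset $\mathrm{top}(G)$ is a lattice, then $\mathrm{top}(G)\simeq\mathcal L(G)$ as posets.
   Context: All directed graphs are finite, acyclic (no directed cycles, hence no loops) and without multiple edges; $g\in G$ means $g$ is a vertex of $G$, and $g\to h$ denotes an edge from $g$ to $h$. The $G$-order is the partial order on vertices with $g_1\ge g_2$ iff there is a directed path (possibly of length $0$) from $g_1$ to $g_2$. An independent set is a set of pairwise non-adjacent vertices. A pair $(\mathcal D,\mathcal U)$ of disjoint independent sets is orthogonal if there is no edge from an element of $\mathcal D$ to an element of $\mathcal U$. An orthogonal pair of independent sets is tight if none of the following operations results in an orthogonal pair of independent sets: removing some $d\in\mathcal D$ and inserting in $\mathcal D$ an element $d'\notin\mathcal D$ with $d'>d$; removing some $u\in\mathcal U$ and inserting in $\mathcal U$ an element $u'\notin\mathcal U$ with $u'<u$; adding a new element to $\mathcal D$; adding a new element to $\mathcal U$. A tight orthogonal pair is called a top, and $\mathrm{top}(G)$ is the set of tops of $G$. A linear extension $\ell$ of $G$-order is a total order on the vertices such that if $g_1\to g_2$ is an edge then $g_2$ precedes $g_1$; a reverse linear extension $\ell'$ is a total order in which $g_1$ precedes $g_2$ whenever $g_1\to g_2$. Flips: for $(\mathcal D,\mathcal U)\in\mathrm{top}(G)$ and $g\in G$, define $\mathrm{flip}_g(\mathcal D,\mathcal U)=(\mathcal D,\mathcal U)$ if $g\notin\mathcal D\cup\mathcal U$. Otherwise start with $\mathcal D'=\{k\in\mathcal D: k\not\le g\}$ and $\mathcal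 U'=\{k\in\mathcal U:k\not\ge g\}$; add $g$ to $\mathcal D'$ if $g\in\mathcal U$, and add $g$ to $\mathcal U'$ if $g\in\mathcal D$. Then, for $k\not\ge g$ in the order of a reverse linear extension $\ell'$, add $k$ to $\mathcal D'$ if $k\notin\mathcal U'$, there is no edge from $k$ to $\mathcal U'$, and there is no edge from the current $\mathcal D'$ to $k$. Then, for $k\not\le g$ in the order of a linear extension $\ell$, add $k$ to $\mathcal U'$ if $k\notin\mathcal D'$, there is no edge from $\mathcal D'$ to $k$, and there is no edge from $k$ to the current $\mathcal U'$. The result $(\mathcal D',\mathcal U')$ is $\mathrm{flip}_g(\mathcal D,\mathcal U)$; it is a top and does not depend on the choice of $\ell,\ell'$. The independence poset, also denoted $\mathrm{top}(G)$, is the set $\mathrm{top}(G)$ with the reflexive and transitive closure of the relations $(\mathcal D,\mathcal U)<\mathrm{flip}_g(\mathcal D,\mathcal U)$ for $g\in\mathcal U$ (this is a partial order). Maximal orthogonal pairs: a pair $(X,Y)$ of disjoint sets of vertices of $G$ (not necessarily independent) with no edge from an element of $X$ to an element of $Y$ is a maximal orthogonal pair if $X$ and $Y$ are both maximal with this property. $\mathcal L(G)$ is the set of maximal orthogonal pairs of $G$ ordered by $(X,Y)\le(X',Y')$ iff $X\subseteq X'$ (equivalently $Y'\subseteq Y$); it is a lattice. *)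

(* Defs.v *)
From mathcomp Require Import all_boot.

Set Implicit Arguments.
Unset Strict Implicit.
Unset Printing Implicit Defensive.

Section IndependencePoset.

(* A directed graph without multiple edges: [e g h] is the edge g -> h. *)
Variables (V : finType) (e : rel V).

(* [cycle e (x :: p)] is the closed walk x -> p_1 -> ... -> p_n -> x;
   [p = [::]] is a loop. *)
Definition acyclic : Prop := forall (x : V) (p : seq V), ~~ cycle e (x :: p).

Definition Gge (g1 g2 : V) : bool := connect e g1 g2.
Definition Ggt (g1 g2 : V) : bool := (g1 != g2) && Gge g1 g2.

Definition no_edge (A B : {set V}) : bool :=
  [forall a in A, forall b in B, ~~ e a b].

Definition independent (A : {set V}) : bool := no_edge A A.

Definition orthogonal_pair (D U : {set V}) : bool :=
  [&& independent D, independent U, [disjoint D & U] & no_edge D U].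

Definition tight (D U : {set V}) : bool :=
  [&& [forall d in D, forall d', (d' \notin D) && Ggt d' d ==>
         ~~ orthogonal_pair (d' |: (D :\ d)) U],
      [forall u in U, forall u', (u' \notin U) && Ggt u u' ==>
         ~~ orthogonal_pair D (u' |: (U :\ u))],
      [forall x, (x \notin D) ==> ~~ orthogonal_pair (x |: D) U]
    & [forall x, (x \notin U) ==> ~~ orthogonal_pair D (x |: U)]].

Definition is_top (p : {set V} * {set V}) : bool :=
  orthogonal_pair p.1 p.2 && tight p.1 p.2.

Definition top : finType := {p : {set V} * {set V} | is_top p}.

(* A total order on the vertices is a duplicate-free listing of all of them
   (a tuple of size [#|V|] without repetition), earliest vertex first. *)
Definition linear_extension (l : #|V|.-tuple V) : bool :=
  uniq l && [forall x, forall y, e x y ==> (index y l < index x l)].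

Definition reverse_linear_extension (l : #|V|.-tuple V) : bool :=
  uniq l && [forall x, forall y, e x y ==> (index x l < index y l)].

Definition fillD (g : V) (U : {set V}) (l' : seq V) (D : {set V}) : {set V} :=
  foldl (fun D k =>
           if [&& ~~ Gge k g, k \notin U, no_edge [set k] U
                & no_edge D [set k]]
           then k |: D else D) D l'.

Definition fillU (g : V) (D : {set V}) (l : seq V) (U : {set V}) : {set V} :=
  foldl (fun U k =>
           if [&& ~~ Gge g k, k \notin D, no_edge D [set k]
                & no_edge [set k] U]
           then k |: U else U) U l.

Definition flip (l l' : seq V) (g : V) (p : {set V} * {set V}) :
    {set V} * {set V} :=
  let: (D, U) := p in
  if g \notin D :|: U then p else
  let D0 := [set k in D | ~~ Gge g k] in
  let U0 := [set k in U | ~~ Gge k g] in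
  let D1 := if g \in U then g |: D0 else D0 in
  let U1 := if g \in D then g |: U0 else U0 in
  let D' := fillD g U1 l' D1 in
  let U' := fillU g D' l U1 in
  (D', U').

(* [flip_up p q] : q = flip_g p for some g in the second component of p.
   On tops, [flip] does not depend on the extensions l and l', so any choice
   of them may be used. *)
Definition flip_up (p q : top) : bool :=
  [exists g in (val p).2,
   exists l : #|V|.-tuple V, exists l' : #|V|.-tuple V,
     [&& linear_extension l, reverse_linear_extension l'
       & val q == flip l l' g (val p)]].

(* [connect] is the reflexive transitive closure. *)
Definition top_le : rel top := connect flip_up.

(* The sets of a maximal orthogonal pair need not be independent. *)
Definition orthogonal_sets (X Y : {set V}) : bool :=
  [disjoint X & Y] && no_edge X Y.

Definition is_mop (p : {set V} * {set V}) : bool :=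
  maxset (fun X => orthogonal_sets X p.2) p.1
  && maxset (fun Y => orthogonal_sets p.1 Y) p.2.

Definition mop : finType := {p : {set V} * {set V} | is_mop p}.

Definition mop_le : rel mop := fun p q => (val p).1 \subset (val q).1.

End IndependencePoset.

Definition is_join (T : Type) (le : rel T) (x y z : T) : Prop :=
  [/\ le x z, le y z & forall w, le x w -> le y w -> le z w].

Definition is_meet (T : Type) (le : rel T) (x y z : T) : Prop :=
  [/\ le z x, le z y & forall w, le w x -> le w y -> le w z].

(* To be applied to a partial order [le]; the order axioms are not repeated. *)
Definition is_lattice (T : Type) (le : rel T) : Prop :=
  forall x y : T, (exists z, is_join le x y z) /\ (exists z, is_meet le x y z).

Definition order_isomorphic (S T : Type) (leS : rel S) (leT : rel T) : Prop :=
  exists f : S -> T, bijective f /\ {mono f : x y / leS x y >-> leT x y}.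

(* Main.v *)
Require Import Defs.
From mathcomp Require Import all_boot.

Set Implicit Arguments.
Unset Strict Implicit.
Unset Printing Implicit Defensive.

(** Say that [x] hits [y] when [x = y] or there is an edge [x -> y].  A pair
    [(D, U)] is orthogonal when no [d] in [D] hits a [u] in [U], and the maximal
    orthogonal pairs are the pairs [(X, Y)] that are polar to each other for
    this relation: [Y] consists of the vertices not hit by [X], and [X] of those
    that do not hit [Y].  The isomorphism sends a top [(D, U)] to
    [(lpolar U, rpolar D)], and everything rests on showing that these two sets
    are orthogonal when the tops form a lattice.

    The order.  Write [hop p q] when [D] of [p] is orthogonal to [U] of [q].
    Every upward flip is a hop ([flip_hop]), and conversely every hop is a chain
    of flips ([hop_flip_chain]), so the order is the transitive closure of
    [hop] ([top_le_hop]) and flips can be forgotten.  Hops increase a weight on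
    the sets [D], dominated by high vertices, so the tops whose [D] has a
    prescribed trace [D0] on an up-closed set [B] form a convex subset
    ([le_convex]); it is a copy of the poset of tops of a smaller graph.

    Completeness.  These arguments need each vertex to be hit by [D] or to hit
    [U].  A tight pair may fail this, but not in a lattice
    ([lattice_complete]).

    Orthogonality of the polars ([rigid_of_meets]).  The proof is by induction
    on the smaller graphs above, splitting off a source [s].  Suppose that in a
    top [p] some [x] left polar to [U] hits some [y] right polar to [D].
    Induction settles everything except the case where [s] lies in [D] and
    points to [x].  Write [t z] for a top with [D = {z}] and [m z] for one with
    [U = {z}], so that [t x <= p <= m y].  Consider the meet [w] of [m y] and
    [m s].  It avoids [s] and lies above [t x], and by induction this forces
    some [z] in its [D] to hit [y].  Since [w] lies above the top with
    [U = {y, s}], induction then gives [t y <= w <= m y].  On a chain from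
    [t y], which avoids [s], to [m y], which contains [s], the step at which [s]
    enters leads to a top where [y] is left polar to [U] and right polar to [D];
    by induction [y] does not hit [y], which is absurd.

    Conclusion.  Orthogonality of the polars makes each step of the order
    monotone for [lpolar U], and inclusion of these sets gives back a hop.  A
    maximal orthogonal pair [(X, Y)] comes from the meet of the [m y] for [y] in
    [Y], which lies above all [t x] for [x] in [X] ([mop_of_top_surj]). *)

(** * Heights and weights in an acyclic digraph *)

Section Heights.
Variables (V : finType) (e : rel V).
Hypothesis acy : acyclic e.

Lemma edge_irr x : ~~ e x x.
Proof. by have := acy x [::]; rewrite /= andbT. Qed.

Lemma edge_no_return x y : e x y -> ~~ connect e y x.
Proof.
move=> exy; apply/negP => /connectP[p pth lst].
by have := acy y p; rewrite /= rcons_path pth -lst exy.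
Qed.

Lemma connect_antisym x y : connect e x y -> connect e y x -> x = y.
Proof.
case/connectP=> [[|z p]] /=; first by move=> _ ->.
case/andP=> exz pth lst cyx; case/negP: (edge_no_return exz).
by apply: connect_trans cyx; apply/connectP; exists p.
Qed.

Definition height x := #|[set y | connect e x y]|.

Lemma height_connect x y : connect e x y -> x != y -> height y < height x.
Proof.
move=> cxy nxy; apply/proper_card/properP; split.
  by apply/subsetP=> z; rewrite !inE; apply: connect_trans.
exists x; rewrite !inE ?connect0 //; apply: contra nxy => cyx.
by rewrite (connect_antisym cxy cyx).
Qed.

Lemma height_edge x y : e x y -> height y < height x.
Proof.
move=> exy; apply: height_connect (connect1 exy) _.
by apply: contraL exy => /eqP->; exact: edge_irr.
Qed.

(** The base exceeds the number of vertices, so a vertex outweighs all lower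
    vertices together and weights are compared at the highest difference. *)
Definition weight (A : {set V}) := \sum_(x in A) #|V|.+1 ^ height x.

Lemma weight_lt (A B : {set V}) :
    (forall a, a \in A -> a \notin B -> exists2 b, b \in B :\: A & e b a) ->
  A != B -> weight A < weight B.
Proof.
move=> domAB nAB.
have [k kBA]: exists k, k \in B :\: A.
  have [BA0|[k kBA]] := set_0Vmem (B :\: A); last by exists k.
  have sBA : B \subset A by rewrite -setD_eq0 BA0.
  suff sAB : A \subset B by rewrite eqEsubset sAB sBA in nAB.
  apply/subsetP=> a aA; apply: contraT => /(domAB a aA)[b].
  by rewrite inE => /andP[/negP bA /(subsetP sBA)].
have [top_k topBA ktop] := arg_maxnP height kBA.
have {}ktop b : b \in B :\: A -> height b <= height top_k by exact: ktop.
have lowA a : a \in A :\: B -> height a <= (height top_k).-1.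
  rewrite inE => /andP[aB aA]; have [b bBA eba] := domAB a aA aB.
  have lt_ak := leq_trans (height_edge eba) (ktop b bBA).
  by rewrite -ltnS (ltn_predK lt_ak).
have hk_gt0 : 0 < height top_k.
  by apply/card_gt0P; exists top_k; rewrite inE connect0.
rewrite /weight (big_setID B) /= [X in _ < X](big_setID A) /= setIC ltn_add2l.
apply: (@leq_trans (#|V|.+1 ^ height top_k)); last first.
  by rewrite (bigD1 top_k) //= leq_addr.
apply: (@leq_ltn_trans (#|V| * #|V|.+1 ^ (height top_k).-1)).
  apply: (@leq_trans (\sum_(a in A :\: B) #|V|.+1 ^ (height top_k).-1)).
    by apply: leq_sum => a /lowA; apply: leq_pexp2l.
  by rewrite sum_nat_const leq_mul2r max_card orbT.
by rewrite -{2}(prednK hk_gt0) expnS ltn_mul2r expn_gt0 ltnSn.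
Qed.

Lemma exists_index_ordering (f : V -> nat) :
  exists2 l : #|V|.-tuple V, uniq l &
    forall x y, f y < f x -> index y l < index x l.
Proof.
pose le x y := f x <= f y.
have sz : size (sort le (enum V)) == #|V| by rewrite size_sort -cardE.
exists (Tuple sz) => [|x y /=]; first by rewrite /= sort_uniq enum_uniq.
have le_tr : transitive le by move=> b a c; apply: leq_trans.
have le_refl : reflexive le by move=> a; apply: leqnn.
have le_tot : total le by move=> a b; apply: leq_total.
apply: contraLR; rewrite -!leqNgt.
by apply: (sorted_leq_index le_tr le_refl (sort_sorted le_tot _));
   rewrite mem_sort mem_enum.
Qed.

Lemma exists_linear_extension : exists l : #|V|.-tuple V, linear_extension e l.
Proof.
have [l ul lP] := exists_index_ordering height.
exists l; rewrite /linear_extension ul; apply/forallP=> x; apply/forallP=> y.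
by apply/implyP=> /height_edge /lP.
Qed.

Lemma exists_reverse_linear_extension :
  exists l : #|V|.-tuple V, reverse_linear_extension e l.
Proof.
have [l ul lP] := exists_index_ordering (fun x => #|V| - height x).
exists l; rewrite /reverse_linear_extension ul.
apply/forallP=> x; apply/forallP=> y; apply/implyP=> /height_edge lt_yx.
by apply/lP/ltn_sub2l/lt_yx/(leq_trans lt_yx)/max_card.
Qed.

End Heights.

(** * Greedy filling *)

Section Greedy.
Variables (V : finType).

Lemma mem_full_tuple (l : #|V|.-tuple V) x : uniq l -> x \in l.
Proof.
move=> ul; have inl : {subset l <= enum V} by move=> t; rewrite mem_enum.
have [|_ ->] := uniq_min_size ul inl; last by rewrite mem_enum.
by rewrite -cardE size_tuple.
Qed.

Lemma index_pairwise (r : rel V) (l : seq V) :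
    uniq l -> (forall x y, r x y -> index x l < index y l) ->
  pairwise (fun x y => ~~ r y x) l.
Proof.
case: l => // x0 l ul rl; apply/(pairwiseP x0) => i j; rewrite !inE => il jl ij.
by apply: contraTN ij => /rl; rewrite !index_uniq // -leqNgt => /ltnW.
Qed.

Variables (P : pred V) (r : rel V).
Implicit Types (S : {set V}) (l : seq V).

(** Both filling phases of a flip are instances: [fillD] with the edge relation
    and [fillU] with its converse. *)
Definition greedy (S : {set V}) (l : seq V) : {set V} :=
  foldl (fun (A : {set V}) k =>
           if P k && [forall s in A, ~~ r s k] then k |: A else A) S l.

Lemma greedy_rcons S l k : greedy S (rcons l k) =
  if P k && [forall s in greedy S l, ~~ r s k] then k |: greedy S l
  else greedy S l.
Proof. by rewrite /greedy foldl_rcons. Qed.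

Lemma sub_greedy S l : S \subset greedy S l.
Proof.
elim/last_ind: l => // l k IH; rewrite greedy_rcons; case: ifP => // _.
exact: subset_trans IH (subsetUr _ _).
Qed.

Lemma greedy_new S l k :
  k \in greedy S l -> k \notin S -> (k \in l) && P k.
Proof.
elim/last_ind: l k => [|l z IH] k; first by move=> /= ->.
rewrite greedy_rcons mem_rcons inE; case: ifP => [/andP[Pz _]|_].
  case/setU1P=> [->|]; first by rewrite eqxx Pz.
  by move=> kS nkS; case/andP: (IH k kS nkS) => -> ->; rewrite orbT.
by move=> kS nkS; case/andP: (IH k kS nkS) => -> ->; rewrite orbT.
Qed.

Lemma greedy_maximal S l k : k \in l -> P k ->
  k \in greedy S l \/ exists2 s, s \in greedy S l & r s k.
Proof.
elim/last_ind: l k => // l z IH k; rewrite mem_rcons inE greedy_rcons => kl Pk.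
have sub : greedy S l \subset
    (if P z && [forall s in greedy S l, ~~ r s z]
     then z |: greedy S l else greedy S l).
  by case: ifP => // _; apply: subsetUr.
case/orP: kl => [/eqP zk|/IH/(_ Pk)[/(subsetP sub)|[s /(subsetP sub)]]];
  [|by left|by right; exists s].
subst z; rewrite Pk /=; case: ifP => [_|/negbT]; first by left; rewrite setU11.
by rewrite negb_forall_in => /exists_inP[s sG /negPn rsk]; right; exists s.
Qed.

(** When [l] lists the sources of [r] first, nothing accepted later can have
    an [r]-edge into an earlier accepted vertex, and the test excludes the
    edges in the other direction. *)
Lemma greedy_new_free S l a b : irreflexive r ->
    pairwise (fun x y => ~~ r y x) l ->
  a \in greedy S l -> b \in greedy S l -> b \notin S -> ~~ r a b.
Proof.
move=> irr; elim/last_ind: l a b => [|l z IH] a b; first by move=> _ _ /= ->.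
rewrite pairwise_rcons => /andP[/allP nrz pl]; rewrite greedy_rcons.
case: ifP => [/andP[_ /forall_inP freez]|_]; last exact: IH.
case/setU1P=> [->|aG]; case/setU1P=> [->|bG] nbS.
- by rewrite irr.
- by case/andP: (greedy_new bG nbS) => /nrz.
- exact: freez.
- exact: IH.
Qed.

End Greedy.

(** * Orthogonality and polars *)

Section Polars.
Variables (V : finType) (e : rel V).
Implicit Types (A B D U : {set V}).

(** Orthogonality of [A] and [B] says that no [a] in [A] hits a [b] in [B]. *)
Definition hits (x y : V) := (x == y) || e x y.

Definition lpolar U := [set x | [forall u in U, ~~ hits x u]].
Definition rpolar D := [set y | [forall d in D, ~~ hits d y]].

Lemma lpolarP U x : reflect (forall u, u \in U -> ~~ hits x u) (x \in lpolar U).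
Proof. by rewrite inE; apply: forall_inP. Qed.

Lemma rpolarP D y : reflect (forall d, d \in D -> ~~ hits d y) (y \in rpolar D).
Proof. by rewrite inE; apply: forall_inP. Qed.

Lemma no_edgeP A B :
  reflect (forall a b, a \in A -> b \in B -> ~~ e a b) (no_edge e A B).
Proof.
apply: (iffP forall_inP) => [H a b /H/forall_inP/(_ b)|H a aA]; first exact.
by apply/forall_inP=> b; apply: H.
Qed.

Lemma hitsxx x : hits x x. Proof. by rewrite /hits eqxx. Qed.

Lemma hits_neq x y : hits x y -> x != y -> e x y.
Proof. by case/orP=> // /eqP->; rewrite eqxx. Qed.

Lemma edge_hits x y : e x y -> hits x y.
Proof. by rewrite /hits orbC => ->. Qed.

Lemma hits_connect x y : hits x y -> connect e x y.
Proof. by case/orP=> [/eqP->|/connect1]. Qed.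

Lemma orthogonal_setsP A B :
  reflect (forall a b, a \in A -> b \in B -> ~~ hits a b) (orthogonal_sets e A B).
Proof.
apply: (iffP andP) => [[dAB /no_edgeP nAB] a b aA bB|H].
  rewrite /hits negb_or nAB // andbT.
  by apply: contraTneq aA => ->; rewrite (disjointFl dAB bB).
split; last by apply/no_edgeP=> a b aA /(H a b aA); rewrite negb_or => /andP[].
apply/pred0Pn=> -[x /= /andP[xA xB]].
by have := H x x xA xB; rewrite hitsxx.
Qed.

Lemma orthogonal_lpolar A B : orthogonal_sets e A B = (A \subset lpolar B).
Proof.
apply/orthogonal_setsP/subsetP => [H a aA|H a b /H/lpolarP]; last exact.
by apply/lpolarP=> b; apply: H.
Qed.

Lemma orthogonal_rpolar A B : orthogonal_sets e A B = (B \subset rpolar A).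
Proof.
apply/orthogonal_setsP/subsetP => [H b bB|H a b aA /H/rpolarP]; last exact.
by apply/rpolarP=> a aA; apply: H.
Qed.

(** Every vertex is hit by [D] or hits [U]: see [completeP]. *)
Definition complete (p : {set V} * {set V}) := [disjoint lpolar p.2 & rpolar p.1].

Lemma completeP (p : {set V} * {set V}) :
  reflect (forall k, (exists2 d, d \in p.1 & hits d k) \/
                     (exists2 u, u \in p.2 & hits k u)) (complete p).
Proof.
apply: (iffP pred0P) => [H k|H k].
  have := H k; rewrite /= !inE; case: forall_inP => [_|/forall_inP] /=.
    move/negbT; rewrite negb_forall_in => /exists_inP[d dD /negPn hdk].
    by left; exists d.
  rewrite negb_forall_in => /exists_inP[u uU /negPn hku] _.
  by right; exists u.
apply/andP=> -[/lpolarP kU /rpolarP kD].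
case: (H k) => [[d /kD/negP]|[u /kU/negP]]; exact.
Qed.

Lemma orthogonal_pairP D U :
  reflect [/\ forall a b, a \in D -> b \in D -> ~~ e a b,
              forall a b, a \in U -> b \in U -> ~~ e a b &
              forall d u, d \in D -> u \in U -> ~~ hits d u]
          (orthogonal_pair e D U).
Proof.
rewrite /orthogonal_pair -[_ && no_edge _ _ _]/(orthogonal_sets e D U).
apply: (iffP and3P) => -[H1 H2 H3];
  split; by [apply/no_edgeP | apply/orthogonal_setsP].
Qed.

End Polars.

Arguments lpolarP {V e U x}.
Arguments rpolarP {V e D y}.

(** * Complete tops *)

Section Tops.
Variables (V : finType) (e : rel V).
Hypothesis acy : acyclic e.
Implicit Types (A B D U : {set V}) (p q r : top e).

Local Notation hits := (hits e).
Local Notation lpolar := (lpolar e).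
Local Notation rpolar := (rpolar e).

(** A change that tightness forbids would bring in a vertex that is hit by [D]
    or hits [U]; the edge witnessing this survives the change, unless its other
    end is the removed vertex, and then it closes a directed cycle. *)
Lemma complete_is_top (p : {set V} * {set V}) :
  orthogonal_pair e p.1 p.2 -> complete e p -> is_top e p.
Proof.
case: p => D U /= orthDU /completeP /= cpl; rewrite /is_top /= orthDU /=.
have no_return x y : connect e y x -> e x y -> False.
  by move=> cyx exy; case/negP: (edge_no_return acy exy).
apply/and4P; split.
- apply/forall_inP=> d dD; apply/forallP=> d'; apply/implyP.
  case/and3P=> d'D nd'd cd'd; apply/negP=> /orthogonal_pairP[iD _ oDU].
  have [[d0 d0D hd0]|[u uU hu]] := cpl d'; last first.
    by have := oDU d' u (setU11 _ _) uU; rewrite hu.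
  have ed0 : e d0 d' by apply: (hits_neq hd0); apply: contraNneq d'D => <-.
  have [dd0|nd0] := eqVneq d0 d; first by subst d0; case: (no_return _ _ cd'd ed0).
  by have := iD d0 d'; rewrite !inE eqxx d0D nd0 orbT ed0 => /(_ isT isT).
- apply/forall_inP=> u uU; apply/forallP=> u'; apply/implyP.
  case/and3P=> u'U nuu' cuu'; apply/negP=> /orthogonal_pairP[_ iU oDU].
  have [[d dD hd]|[u0 u0U hu0]] := cpl u'.
    by have := oDU d u' dD (setU11 _ _); rewrite hd.
  have eu0 : e u' u0 by apply: (hits_neq hu0); apply: contraNneq u'U => ->.
  have [uu0|nu0] := eqVneq u0 u; first by subst u0; case: (no_return _ _ cuu' eu0).
  by have := iU u' u0; rewrite !inE eqxx u0U nu0 orbT eu0 => /(_ isT isT).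
- apply/forallP=> x; apply/implyP=> xD; apply/negP=> /orthogonal_pairP[iD _ oDU].
  have [[d dD hd]|[u uU hu]] := cpl x.
    have /negP[] := iD d x (setU1r _ dD) (setU11 _ _).
    by apply: (hits_neq hd); apply: contraNneq xD => <-.
  by have := oDU x u (setU11 _ _) uU; rewrite hu.
apply/forallP=> x; apply/implyP=> xU; apply/negP=> /orthogonal_pairP[_ iU oDU].
have [[d dD hd]|[u uU hu]] := cpl x.
  by have := oDU d x dD (setU11 _ _); rewrite hd.
have /negP[] := iU x u (setU11 _ _) (setU1r _ uU).
by apply: (hits_neq hu); apply: contraNneq xU => ->.
Qed.

Lemma top_orthP p :
  [/\ forall a b, a \in (val p).1 -> b \in (val p).1 -> ~~ e a b,
      forall a b, a \in (val p).2 -> b \in (val p).2 -> ~~ e a b &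
      forall d u, d \in (val p).1 -> u \in (val p).2 -> ~~ hits d u].
Proof. by apply/orthogonal_pairP; case/andP: (valP p). Qed.

Lemma top_indepD p a b : a \in (val p).1 -> b \in (val p).1 -> ~~ e a b.
Proof. by have [iD _ _] := top_orthP p; apply: iD. Qed.

Lemma top_indepU p a b : a \in (val p).2 -> b \in (val p).2 -> ~~ e a b.
Proof. by have [_ iU _] := top_orthP p; apply: iU. Qed.

Lemma top_orth p d u : d \in (val p).1 -> u \in (val p).2 -> ~~ hits d u.
Proof. by have [_ _ oDU] := top_orthP p; apply: oDU. Qed.

Lemma D_sub_lpolar p d : d \in (val p).1 -> d \in lpolar ((val p).2).
Proof. by move=> dD; apply/lpolarP=> u uU; apply: top_orth dD uU. Qed.

Lemma U_sub_rpolar p u : u \in (val p).2 -> u \in rpolar ((val p).1).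
Proof. by move=> uU; apply/rpolarP=> d dD; apply: top_orth dD uU. Qed.

Definition upclosed B := forall x y, e x y -> y \in B -> x \in B.

(** A complete top is determined by [D] on an up-closed set [B] and by [U] off [B], and
    both can be prescribed: [U] is filled greedily inside [B], sinks first, and
    then [D] outside [B], sources first. *)
Lemma exists_top B D0 U0 : upclosed B ->
    D0 \subset B -> [disjoint U0 & B] -> no_edge e D0 D0 -> no_edge e U0 U0 ->
    orthogonal_sets e D0 U0 ->
  exists p, [/\ complete e (val p), (val p).1 :&: B = D0 & (val p).2 :\: B = U0].
Proof.
move=> upB /subsetP sD0 dU0 /no_edgeP iD0 /no_edgeP iU0 /orthogonal_setsP o0.
have [l /andP[ul lP]] := exists_linear_extension acy.
have [l' /andP[ul' lP']] := exists_reverse_linear_extension acy.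
have pl : pairwise (fun x y => ~~ e x y) l.
  apply: (@index_pairwise _ (fun x y => e y x) l ul) => x y exy.
  by have /forallP/(_ y)/forallP/(_ x)/implyP/(_ exy) := lP.
have pl' : pairwise (fun x y => ~~ e y x) l'.
  apply: index_pairwise => // x y exy.
  by have /forallP/(_ x)/forallP/(_ y)/implyP/(_ exy) := lP'.
have irr : irreflexive e by move=> x; apply/negbTE/edge_irr.
pose PU k := (k \in B) && (k \in rpolar D0).
pose U := greedy PU (fun x y => e y x) U0 l.
pose PD k := (k \notin B) && (k \in lpolar U).
pose D := greedy PD e D0 l'.
have U0B u : u \in U0 -> u \notin B by move/(disjointFr dU0)->.
have newU u : u \in U -> u \notin U0 -> PU u.
  by move=> uU /(greedy_new uU)/andP[].
have newD d : d \in D -> d \notin D0 -> PD d.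
  by move=> dD /(greedy_new dD)/andP[].
have o0U d u : d \in D0 -> u \in U -> ~~ hits d u.
  move=> dD0 uU; have [/o0->//|/(newU u uU)] := boolP (u \in U0).
  by case/andP=> _ /rpolarP->.
have oDU d u : d \in D -> u \in U -> ~~ hits d u.
  move=> dD uU; have [/o0U->//|/(newD d dD)] := boolP (d \in D0).
  by case/andP=> _ /lpolarP->.
have iD a b : a \in D -> b \in D -> ~~ e a b.
  move=> aD bD; have [bD0|nb] := boolP (b \in D0); last first.
    exact: greedy_new_free irr pl' aD bD nb.
  have [aD0|na] := boolP (a \in D0); first exact: iD0.
  have /andP[aB _] := newD a aD na.
  by apply: contra aB => eab; apply: upB eab (sD0 _ bD0).
have iU a b : a \in U -> b \in U -> ~~ e a b.
  move=> aU bU; have [aU0|na] := boolP (a \in U0); last first.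
    exact: (@greedy_new_free _ PU (fun x y => e y x) U0 l b a irr).
  have [bU0|nb] := boolP (b \in U0); first exact: iU0.
  have /andP[bB _] := newU b bU nb.
  by apply: contra (U0B a aU0) => eab; apply: upB eab bB.
have cpl : complete e (D, U).
  apply/completeP => k /=; have [kB|kB] := boolP (k \in B).
    have [kD0|] := boolP (k \in rpolar D0).
      right.
      have [||kU|[s sU eks]] := @greedy_maximal _ PU (fun x y => e y x) U0 l k.
      - exact: mem_full_tuple.
      - by rewrite /PU kB.
      - by exists k => //; apply: hitsxx.
      by exists s => //; apply: edge_hits.
    rewrite inE negb_forall_in => /exists_inP[d dD0 /negPn hdk].
    by left; exists d => //; apply: (subsetP (sub_greedy _ _ _ _)).
  have [kU|] := boolP (k \in lpolar U).
    left; have [||kD|[s sD esk]] := @greedy_maximal _ PD e D0 l' k.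
    - exact: mem_full_tuple.
    - by rewrite /PD kB.
    - by exists k => //; apply: hitsxx.
    by exists s => //; apply: edge_hits.
  rewrite inE negb_forall_in => /exists_inP[u uU /negPn hku].
  by right; exists u.
have tDU : is_top e (D, U) by apply: complete_is_top => //; apply/orthogonal_pairP.
exists (Sub (D, U) tDU); rewrite SubK; split=> //=.
  apply/setP=> x; rewrite inE; apply/andP/idP=> [[xD xB]|xD0].
    by apply: contraTT xB => /(newD x xD)/andP[].
  by split; [apply: (subsetP (sub_greedy _ _ _ _)) | apply: sD0].
apply/setP=> x; rewrite inE; apply/andP/idP=> [[xB xU]|xU0].
  by apply: contraTT xB => /(newU x xU)/andP[-> _].
by split; [apply: U0B | apply: (subsetP (sub_greedy _ _ _ _))].
Qed.

End Tops.
(** * The order generated by hops *)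

Section Hops.
Variables (V : finType) (e : rel V).
Hypothesis acy : acyclic e.
Hypothesis all_complete : forall p : top e, complete e (val p).
Implicit Types (A B D U : {set V}) (p q r : top e).

Local Notation hits := (hits e).
Local Notation lpolar := (lpolar e).
Local Notation rpolar := (rpolar e).
Local Notation Dset p := (val (p : top e)).1.
Local Notation Uset p := (val (p : top e)).2.

Definition hop : rel (top e) :=
  fun p q => orthogonal_sets e (Dset p) (Uset q).

Lemma hopP p q :
  reflect (forall d u, d \in Dset p -> u \in Uset q -> ~~ hits d u) (hop p q).
Proof. exact: orthogonal_setsP. Qed.

Lemma hop_refl p : hop p p. Proof. by apply/hopP=> d u; apply: top_orth. Qed.

Lemma lpolar_hit p x : x \in lpolar (Uset p) -> exists2 d, d \in Dset p & hits d x.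
Proof.
by move/lpolarP=> xU; have /completeP/(_ x)[//|[u /xU/negP]] := all_complete p.
Qed.

Lemma rpolar_hit p y : y \in rpolar (Dset p) -> exists2 u, u \in Uset p & hits y u.
Proof.
by move/rpolarP=> yD; have /completeP/(_ y)[[d /yD/negP]|//] := all_complete p.
Qed.

(** An element lost from [D] along a hop lies below an element gained: it
    avoids the new [U], so completeness provides an element of the new [D]
    pointing to it. *)
Lemma hop_dominated B p q : upclosed e B -> hop p q ->
  forall a, a \in Dset p :&: B -> a \notin Dset q :&: B ->
  exists2 b, b \in (Dset q :&: B) :\: (Dset p :&: B) & e b a.
Proof.
move=> upB /hopP pq a /setIP[aD aB]; rewrite inE aB andbT => aDq.
have aU : a \in lpolar (Uset q) by apply/lpolarP=> u; apply: pq.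
have [b bD hba] := lpolar_hit aU.
have eba : e b a by apply: hits_neq hba _; apply: contraNneq aDq => <-.
exists b => //; rewrite !inE bD (upB _ _ eba aB) !andbT.
by apply: contraL eba => bDp; apply: top_indepD bDp aD.
Qed.

Lemma hop_weight B p q : upclosed e B -> hop p q ->
  weight e (Dset p :&: B) <= weight e (Dset q :&: B) ?=
    iff (Dset p :&: B == Dset q :&: B).
Proof.
move=> upB pq; have [->|npq] := eqVneq; first exact/leqif_refl.
by apply/leqifP; apply: weight_lt (hop_dominated upB pq) npq.
Qed.

(** The weight of the trace of [D] on an up-closed set never decreases along
    the order, and is constant only if the trace is. *)
Lemma le_weight B p q : upclosed e B -> connect hop p q ->
  weight e (Dset p :&: B) <= weight e (Dset q :&: B) ?=
    iff (Dset p :&: B == Dset q :&: B).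
Proof.
move=> upB /connectP[s]; elim: s p => [|p1 s IH] p /=.
  by move=> _ ->; rewrite eqxx; apply/leqif_refl.
case/andP=> pp1 pth lst; have [le1 eq1] := hop_weight upB pp1.
have [le2 eq2] := IH p1 pth lst; split; first exact: leq_trans le2.
apply/idP/idP=> [/eqP w|/eqP->//].
have /eqP w1 : weight e (Dset p :&: B) == weight e (Dset p1 :&: B).
  by rewrite eqn_leq le1 w le2.
have := eqxx (weight e (Dset p :&: B)); rewrite {2}w1 eq1 => /eqP->.
by rewrite -eq2 -w1 w.
Qed.

(** The interval between two tops that agree on an up-closed set [B] consists
    of tops with the same trace on [B]: the weight on [B] cannot change. *)
Lemma le_convex B p q r : upclosed e B ->
    connect hop p q -> connect hop q r -> Dset p :&: B = Dset r :&: B ->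
  Dset q :&: B = Dset p :&: B.
Proof.
move=> upB pq qr pr; have [le1 eq1] := le_weight upB pq.
have [le2 _] := le_weight upB qr.
by apply/esym/eqP; rewrite -eq1 eqn_leq le1 pr le2.
Qed.

(** Between tops that agree on [B], a source of the rest of the graph can enter
    [D] but never leave it: otherwise the weight on [s |: B] would drop. *)
Lemma le_source B s p q : upclosed e (s |: B) -> upclosed e B -> s \notin B ->
    connect hop p q -> Dset p :&: B = Dset q :&: B ->
  s \in Dset p -> s \in Dset q.
Proof.
move=> upsB upB sB pq eqB sp; apply: contraT => sq.
have [lew eqw] := le_weight upsB pq.
have Dq : Dset q :&: (s |: B) = Dset q :&: B.
  by apply/setP=> x; rewrite !inE; case: eqVneq => // ->; rewrite (negPf sq).
have Dp : Dset p :&: (s |: B) = s |: (Dset p :&: B).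
  by apply/setP=> x; rewrite !inE; case: eqVneq => // ->; rewrite sp.
move: lew; rewrite Dp Dq eqB /weight big_setU1 ?inE ?(negPf sB) ?andbF //=.
by rewrite -[X in _ <= X]add0n leq_add2r leqn0 expn_eq0.
Qed.

Lemma path_crossing (S : pred (top e)) p q : connect hop p q -> S p -> ~~ S q ->
  exists v1 v2, [/\ connect hop p v1, hop v1 v2, connect hop v2 q, S v1 & ~~ S v2].
Proof.
case/connectP=> s; elim: s p => [|p1 s IH] p /=; first by move=> _ -> ->.
case/andP=> pp1 pth lst Sp nSq; have [Sp1|nSp1] := boolP (S p1); last first.
  by exists p, p1; split=> //; apply/connectP; exists s.
have [v1 [v2 [p1v1 v12 v2q Sv1 Sv2]]] := IH p1 pth lst Sp1 nSq.
by exists v1, v2; split=> //; apply: connect_trans (connect1 pp1) p1v1.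
Qed.

(** * Tops in a lattice have mutually polar sides *)

(** The tops with [D :&: B = D0], for up-closed [B], form a copy of the top
    poset of the graph induced on the vertices outside [B] that [D0] does not
    point to.  [rigid B D0] says that in this smaller graph [x] hits no [y]
    whenever [x] is left polar to [U] and [y] is right polar to [D]. *)
Definition rigid B D0 := forall p x y, Dset p :&: B = D0 ->
  x \notin B -> y \notin B -> x \in rpolar D0 ->
  x \in lpolar (Uset p) -> y \in rpolar (Dset p) -> ~~ hits x y.

Lemma hits_up B x y : upclosed e B -> x \notin B -> y \in B -> ~~ hits x y.
Proof.
move=> upB xB yB; apply: contra xB => /orP[/eqP->//|exy]; exact: upB exy yB.
Qed.

Section Slice.
Variables (B D0 : {set V}).
Hypotheses (upB : upclosed e B) (rig : rigid B D0).

Lemma slice_sub p d : Dset p :&: B = D0 -> d \in D0 -> d \in Dset p /\ d \in B.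
Proof. by move=> <- /setIP. Qed.

Lemma slice_hop p q : Dset p :&: B = D0 -> Dset q :&: B = D0 ->
    (forall d u, d \in Dset p :\: B -> u \in Uset q :\: B -> ~~ hits d u) ->
  hop p q.
Proof.
move=> pB qB H; apply/hopP=> d u dp uq; have [dB|dB] := boolP (d \in B).
  have dD0 : d \in D0 by rewrite -pB inE dp.
  by have [dq _] := slice_sub qB dD0; apply: top_orth dq uq.
have [uB|uB] := boolP (u \in B); first exact: hits_up uB.
by apply: H; rewrite inE ?dB ?uB.
Qed.

(** In a rigid slice, hops enlarge [lpolar U] and shrink [rpolar D], up to the
    vertices of the smaller graph. *)
Lemma rigid_hop_lpolar p q x : Dset p :&: B = D0 -> hop p q ->
    x \notin B -> x \in rpolar D0 -> x \in lpolar (Uset p) ->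
  x \in lpolar (Uset q).
Proof.
move=> pB /hopP pq xB xD0 xp; apply/lpolarP=> u uq.
have [uB|uB] := boolP (u \in B); first exact: hits_up uB.
by apply: (rig pB) => //; apply/rpolarP=> d dp; apply: pq.
Qed.

Lemma rigid_hop_rpolar p q y : Dset p :&: B = D0 -> Dset q :&: B = D0 ->
    hop p q -> y \notin B -> y \in rpolar (Dset q) -> y \in rpolar (Dset p).
Proof.
move=> pB qB /hopP pq yB yq; apply/rpolarP=> d dp.
have [dB|dB] := boolP (d \in B).
  have dD0 : d \in D0 by rewrite -pB inE dp.
  by have [dq _] := slice_sub qB dD0; apply: (rpolarP yq).
apply: (rig qB) => //; last by apply/lpolarP=> u; apply: pq.
apply/rpolarP=> d0 /(slice_sub pB)[d0p d0B]; rewrite /hits negb_or.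
by rewrite (top_indepD d0p dp) andbT; apply: contraNneq dB => <-.
Qed.

Lemma slice_le_ind (Q : rel (top e)) : reflexive Q -> transitive Q ->
    (forall p q, Dset p :&: B = D0 -> Dset q :&: B = D0 -> hop p q -> Q p q) ->
  forall p q, Dset p :&: B = D0 -> Dset q :&: B = D0 -> connect hop p q -> Q p q.
Proof.
move=> Qrefl Qtr Qhop p q pB qB /connectP[s].
elim: s p pB => [|p1 s IH] p pB /=; first by move=> _ ->.
case/andP=> pp1 pth lst.
have p1q : connect hop p1 q by apply/connectP; exists s.
have p1B : Dset p1 :&: B = D0.
  by rewrite (le_convex upB (connect1 pp1) p1q) ?pB.
exact: Qtr (Qhop _ _ pB p1B pp1) (IH p1 p1B pth lst).
Qed.

Lemma rigid_le_lpolar p q x : Dset p :&: B = D0 -> Dset q :&: B = D0 ->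
    connect hop p q -> x \notin B -> x \in rpolar D0 ->
  x \in lpolar (Uset p) -> x \in lpolar (Uset q).
Proof.
move=> pB qB pq xB xD0; apply/implyP; move: p q pB qB pq.
apply: slice_le_ind => [p|q p r /implyP pq /implyP qr|p q pB _ pq];
  apply/implyP=> //.
  by move/pq/qr.
exact: rigid_hop_lpolar.
Qed.

Lemma rigid_le_rpolar p q y : Dset p :&: B = D0 -> Dset q :&: B = D0 ->
    connect hop p q -> y \notin B ->
  y \in rpolar (Dset q) -> y \in rpolar (Dset p).
Proof.
move=> pB qB pq yB; apply/implyP; move: p q pB qB pq.
apply: slice_le_ind => [p|q p r /implyP pq /implyP qr|p q pB qB pq];
  apply/implyP=> //.
  by move/qr/pq.
exact: rigid_hop_rpolar.
Qed.

End Slice.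

Lemma exists_top_D D0 : no_edge e D0 D0 -> exists p, Dset p = D0.
Proof.
move=> iD0; have [||||||p [_ pD _]] := @exists_top _ e acy setT D0 set0 => //.
- by rewrite -setI_eq0 set0I.
- by apply/no_edgeP=> a b; rewrite inE.
- by apply/orthogonal_setsP=> a b _; rewrite inE.
by exists p; rewrite -pD setIT.
Qed.

Lemma exists_top_slice B D0 U0 : upclosed e B -> D0 \subset B ->
    no_edge e D0 D0 -> {in U0, forall u, u \notin B} -> no_edge e U0 U0 ->
    {in U0, forall u, u \in rpolar D0} ->
  exists p, Dset p :&: B = D0 /\ Uset p :\: B = U0.
Proof.
move=> upB sD0 iD0 U0B iU0 oDU.
have [||||||p [_ pD pU]] := @exists_top _ e acy B D0 U0 => //; last by exists p.
  by apply/pred0Pn=> -[u /= /andP[/U0B/negP]].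
by rewrite orthogonal_rpolar; apply/subsetP.
Qed.

Lemma maximal_outside B : upclosed e B -> B != setT ->
  exists2 s, s \notin B & upclosed e (s |: B).
Proof.
move=> upB; rewrite -subTset => /subsetPn[x0 _ x0B].
have [s sB smax] := arg_maxnP (P := [pred x | x \notin B]) (height e) x0B.
exists s => // x y exy /setU1P[ys|yB]; last by rewrite inE (upB _ _ exy yB) orbT.
rewrite ys in exy; rewrite inE; apply/orP; right; apply: contraLR exy => /smax hx.
by apply: contraTN hx => /(height_edge acy); rewrite ltnNge.
Qed.

(** Induction on the vertices outside [B], one of which, [s], has all its
    predecessors in [B]: the tops of the slice split into those avoiding [s],
    with trace [D0] on [s |: B], and those containing [s], with trace
    [s |: D0], and both halves are rigid.  The meet is needed only when [p]
    contains [s] and [s] points to [x], since then the larger trace no longer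
    admits [x]. *)
Lemma rigid_of_meets B D0 :
    (forall p q, exists r, is_meet (connect hop) p q r) ->
  upclosed e B -> rigid B D0.
Proof.
move=> meets; have [n] := ubnP #|~: B|; elim: n B D0 => // n IH B D0 ltBn upB.
move=> p x y pB xB yB xD0 xU yD; apply/negP=> hxy.
have [|s sB upsB] := maximal_outside upB.
  by apply: contraNneq xB => ->; rewrite inE.
have {}IH D1 : rigid (s |: B) D1.
  apply: IH upsB; rewrite -ltnS; apply: leq_trans ltBn; rewrite ltnS.
  apply/proper_card/properP; split; first by rewrite setCS subsetUr.
  by exists s; rewrite !inE ?eqxx.
have pred_s a : e a s -> a \in B.
  move=> eas; have := upsB _ _ eas (setU11 _ _); case/setU1P=> // as_.
  by rewrite as_ (negPf (edge_irr acy s)) in eas.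
have sD0 : D0 \subset B by rewrite -pB subsetIr.
have D0p d : d \in D0 -> d \in Dset p by rewrite -pB => /setIP[].
have sND0 : s \notin D0 by apply: contra sB => /(subsetP sD0).
have slice0 q : Dset q :&: B = D0 -> s \notin Dset q -> Dset q :&: (s |: B) = D0.
  move=> <- sq; apply/setP=> z; rewrite !inE.
  by case: eqVneq => // ->; rewrite (negPf sq).
have slice1 q : Dset q :&: B = D0 -> s \in Dset q ->
    Dset q :&: (s |: B) = s |: D0.
  by move=> <- sq; apply/setP=> z; rewrite !inE; case: eqVneq => // ->; rewrite sq.
have xNs : x != s.
  apply/eqP=> xs; have [d dp hdx] := lpolar_hit xU.
  have [dx|ndx] := eqVneq d x.
    by have := rpolarP yD d dp; rewrite dx hxy.
  have edx := hits_neq hdx ndx; rewrite xs in edx.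
  have dD0 : d \in D0 by rewrite -pB inE dp pred_s.
  by have := rpolarP xD0 d dD0; rewrite hdx.
have yNs : y != s.
  apply: contraNneq xB => ys; apply: pred_s; rewrite -ys.
  by apply: hits_neq hxy _; rewrite ys.
have notsB z : z \notin B -> z != s -> z \notin s |: B.
  by move=> zB zs; rewrite !inE negb_or zs.
have xsB := notsB x xB xNs; have ysB := notsB y yB yNs.
have [sp|sp] := boolP (s \in Dset p); last first.
  by have := IH D0 p x y (slice0 p pB sp) xsB ysB xD0 xU yD; rewrite hxy.
have nhsy : ~~ hits s y := rpolarP yD s sp.
have yD0 : y \in rpolar D0 by apply/rpolarP=> d /D0p; apply: rpolarP.
have rpolar_s z : z \in rpolar D0 -> ~~ hits s z -> z \in rpolar (s |: D0).
  by move/rpolarP=> zD0 nhsz; apply/rpolarP=> d /setU1P[->|/zD0].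
have [hsx|nhsx] := boolP (hits s x); last first.
  have := IH (s |: D0) p x y (slice1 p pB sp) xsB ysB.
  by rewrite hxy => H; have := H (rpolar_s x xD0 nhsx) xU yD.
(* From here on [s] lies in [D] of [p] and points to [x].  In the smaller graph
   of the slice, [tx] and [ty] are the tops with [D = {x}] and [D = {y}], while
   [my], [ms] and [mys] are those with [U = {y}], [U = {s}] and [U = {y, s}]. *)
have iD0 : no_edge e D0 D0.
  by apply/no_edgeP=> a b /D0p ap /D0p bp; apply: top_indepD bp.
have sD0' : s \in rpolar D0.
  apply/rpolarP=> d dD0; rewrite /hits negb_or (top_indepD (D0p d dD0) sp) andbT.
  by apply: contraNneq sND0 => <-.
have exists_t z : z \notin B -> z \in rpolar D0 ->
    exists t, Dset t = z |: D0 /\ Dset t :&: B = D0.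
  move=> zB zD0; have [|t tD] := @exists_top_D (z |: D0).
    apply/no_edgeP=> a b /setU1P[->|aD0] /setU1P[->|bD0].
    - exact: edge_irr.
    - by apply: contra zB => /upB; apply; apply: (subsetP sD0).
    - by have := rpolarP zD0 a aD0; rewrite negb_or => /andP[].
    - exact: (no_edgeP _ _ _ iD0).
  exists t; split=> //; rewrite tD; apply/setP=> a; rewrite !inE.
  have [->|_] := eqVneq a z; first by rewrite (negPf zB); apply/esym/negP=>
    /(subsetP sD0) zB'; rewrite zB' in zB.
  by rewrite andbC; case: (boolP (a \in B)) => //= aB; apply/esym/negP=>
    /(subsetP sD0) aB'; rewrite aB' in aB.
have exists_m z : z \notin B -> z \in rpolar D0 ->
    exists m, Dset m :&: B = D0 /\ Uset m :\: B = [set z].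
  move=> zB zD0; apply: exists_top_slice => //.
  - by move=> u /set1P->.
  - by apply/no_edgeP=> a b /set1P-> /set1P->; apply: edge_irr.
  - by move=> u /set1P->.
have [tx [txD txB]] := exists_t x xB xD0.
have [ty [tyD tyB]] := exists_t y yB yD0.
have [my [myB myU]] := exists_m y yB yD0.
have [ms [msB msU]] := exists_m s sB sD0'.
have [|||mys [mysB mysU]] := @exists_top_slice B D0 [set y; s] upB sD0 iD0.
- by move=> u /set2P[]->.
- apply/no_edgeP=> a b /set2P[]-> /set2P[]->; rewrite ?(negPf (edge_irr acy _)) //.
    by apply: contra yB => /pred_s.
  by move: nhsy; rewrite negb_or => /andP[].
- by move=> u /set2P[]->.
have txp : hop tx p.
  apply/hopP=> d u; rewrite txD => /setU1P[->|/D0p dp] up; first exact: (lpolarP xU).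
  exact: top_orth dp up.
have pmy : hop p my.
  apply: (slice_hop upB pB myB)=> d u /setDP[dp _]; rewrite myU => /set1P->.
  exact: (rpolarP yD).
have txms : hop tx ms.
  apply: (slice_hop upB txB msB)=> d u.
  rewrite msU txD => /setDP[/setU1P[->|/(subsetP sD0)->//] _] /set1P->.
  by apply: contra xB => hxs; apply: pred_s; apply: hits_neq hxs xNs.
have txmy : connect hop tx my := connect_trans (connect1 txp) (connect1 pmy).
have [w [wmy wms wmeet]] := meets my ms.
have txw : connect hop tx w by apply: wmeet => //; apply: connect1.
have wB : Dset w :&: B = D0 by rewrite (le_convex upB txw wmy) ?txB.
have uU q u (A : {set V}) : Uset q :\: B = A -> u \in A -> u \in Uset q.
  by move=> <- /setDP[].
have notD q u : u \in Uset q -> u \notin Dset q.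
  by move=> uq; apply/negP=> ud; have := top_orth ud uq; rewrite hitsxx.
have sms : s \notin Dset ms by apply/notD/(uU _ _ _ msU)/set11.
have sw : s \notin Dset w.
  by apply: contra sms; apply: (le_source upsB upB sB wms); rewrite wB.
have smys : s \notin Dset mys by apply/notD/(uU _ _ _ mysU)/set22.
have stx : s \notin Dset tx by rewrite txD !inE negb_or eq_sym xNs.
have sty : s \notin Dset ty by rewrite tyD !inE negb_or eq_sym yNs.
have xw : x \in lpolar (Uset w).
  apply: (rigid_le_lpolar upsB (IH D0) (slice0 _ txB stx) (slice0 _ wB sw)) => //.
  by apply: D_sub_lpolar; rewrite txD setU11.
have [z zw hzy] : exists2 z, z \in Dset w & hits z y.
  have : y \notin rpolar (Dset w).
    apply: contraL hxy => yw; exact: (IH D0 w x y (slice0 _ wB sw)).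
  by rewrite inE negb_forall_in => /exists_inP[z zw /negPn hzy]; exists z.
have mysw : connect hop mys w.
  apply: wmeet; apply: connect1.
    apply: (slice_hop upB mysB myB) => d u /setDP[dD _].
    by rewrite myU => /set1P->; apply: top_orth dD (uU _ _ _ mysU (set21 _ _)).
  apply: (slice_hop upB mysB msB) => d u /setDP[dD _].
  by rewrite msU => /set1P->; apply: top_orth dD (uU _ _ _ mysU (set22 _ _)).
(* If [y] hit [u] in [U] of [w], then [u] would hit [U] of [mys], hence hit [y]
   itself; as [z] rules out [u = y], this is a cycle. *)
have yw : y \in lpolar (Uset w).
  apply/lpolarP=> u uw; apply/negP=> hyu.
  have usB : u \notin s |: B by apply: contraL hyu; apply: hits_up.
  have /rpolar_hit[u' u'U huu'] : u \in rpolar (Dset mys).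
    apply: (rigid_le_rpolar upsB (IH D0) (slice0 _ mysB smys)
                            (slice0 _ wB sw)) => //.
    exact: U_sub_rpolar.
  have uNy : u != y by apply: contraL hzy => /eqP<-; apply: top_orth zw uw.
  have [u'B|u'B] := boolP (u' \in s |: B).
    by have := hits_up upsB usB u'B; rewrite huu'.
  have : u' \in [set y; s].
    by rewrite -mysU inE u'U andbT; apply: contra u'B; apply: setU1r.
  case/set2P=> u'E; last by rewrite u'E setU11 in u'B.
  have eyu : e y u by apply: hits_neq hyu _; rewrite eq_sym.
  have /negP[] := edge_no_return acy eyu.
  by apply: hits_connect; rewrite -u'E.
have tyw : hop ty w.
  apply/hopP=> d u; rewrite tyD => /setU1P[->|] ; first exact: (lpolarP yw).
  by rewrite -wB => /setIP[dw _]; apply: top_orth dw.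
have tymy : connect hop ty my := connect_trans (connect1 tyw) wmy.
have smy : s \in Dset my.
  by apply: (le_source upsB upB sB (connect1 pmy)) => //; rewrite pB.
(* [ty] lies in the slice avoiding [s] and [my] in the slice containing [s]:
   where a chain between them changes slice, [y] becomes polar on both sides. *)
have [|v1 [v2 [tyv1 v12 v2my sv1 sv2]]] :=
  path_crossing (S := fun q => s \notin Dset q) tymy sty; first by rewrite negbK.
rewrite negbK in sv2.
have tyv2 := connect_trans tyv1 (connect1 v12).
have v1B : Dset v1 :&: B = D0.
  by rewrite (le_convex upB tyv1 (connect_trans (connect1 v12) v2my)) ?tyB.
have v2B : Dset v2 :&: B = D0 by rewrite (le_convex upB tyv2 v2my) ?tyB.
have yv1 : y \in lpolar (Uset v1).
  apply: (rigid_le_lpolar upsB (IH D0) (slice0 _ tyB sty) (slice0 _ v1B sv1)) => //.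
  by apply: D_sub_lpolar; rewrite tyD setU11.
have yv2 : y \in lpolar (Uset v2).
  exact: (rigid_hop_lpolar upsB (IH D0) (slice0 _ v1B sv1) v12).
have y_v2 : y \in rpolar (Dset v2).
  apply: (rigid_le_rpolar upsB (IH (s |: D0)) (slice1 _ v2B sv2)
                          (slice1 _ myB smy)) => //.
  exact/U_sub_rpolar/(uU _ _ _ myU)/set11.
have := IH (s |: D0) v2 y y (slice1 _ v2B sv2) ysB ysB
  (rpolar_s y yD0 nhsy) yv2 y_v2.
by rewrite hitsxx.
Qed.

End Hops.
(** * Flips are hops *)

Section Flips.
Variables (V : finType) (e : rel V).
Hypothesis acy : acyclic e.
Implicit Types (A B D U : {set V}) (p q r : top e).

Local Notation hits := (hits e).
Local Notation lpolar := (lpolar e).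
Local Notation rpolar := (rpolar e).
Local Notation Dset p := (val (p : top e)).1.
Local Notation Uset p := (val (p : top e)).2.

Lemma mem_lpolarE U k : (k \in lpolar U) = (k \notin U) && no_edge e [set k] U.
Proof.
rewrite -sub1set -orthogonal_lpolar /orthogonal_sets disjoints1.
by [].
Qed.

Lemma mem_rpolarE D k : (k \in rpolar D) = (k \notin D) && no_edge e D [set k].
Proof.
by rewrite -sub1set -orthogonal_rpolar /orthogonal_sets disjoint_sym disjoints1.
Qed.

Lemma no_edge1r D k : no_edge e D [set k] = [forall d in D, ~~ e d k].
Proof.
apply/no_edgeP/forall_inP=> [H d dD|H d b /H nb /set1P->//].
by apply: H; rewrite ?set11.
Qed.

Lemma no_edge1l U k : no_edge e [set k] U = [forall u in U, ~~ e k u].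
Proof.
apply/no_edgeP/forall_inP=> [H u uU|H b u /set1P-> /H//].
by apply: H; rewrite ?set11.
Qed.

Lemma fillD_greedy g U l D :
  fillD e g U l D = greedy (fun k => ~~ connect e k g && (k \in lpolar U)) e D l.
Proof.
rewrite /fillD /greedy; elim: l D => //= k l IH D; rewrite IH; congr foldl.
by rewrite mem_lpolarE /Gge no_edge1r -!andbA.
Qed.

Lemma fillU_greedy g D l U :
  fillU e g D l U =
    greedy (fun k => ~~ connect e g k && (k \in rpolar D)) (fun x y => e y x) U l.
Proof.
rewrite /fillU /greedy; elim: l U => //= k l IH U; rewrite IH; congr foldl.
by rewrite mem_rpolarE /Gge no_edge1l -!andbA.
Qed.

Section OneFlip.
Variables (p : top e) (g : V) (l l' : #|V|.-tuple V).
Hypotheses (gU : g \in Uset p).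
Hypotheses (extl : linear_extension e l) (extl' : reverse_linear_extension e l').

Let D0 := [set k in Dset p | ~~ connect e g k].
Let U0 := [set k in Uset p | ~~ connect e k g].
Let q := flip e l l' g (val p).
Let PD k := ~~ connect e k g && (k \in lpolar U0).
Let PU k := ~~ connect e g k && (k \in rpolar q.1).

Let gD : g \notin Dset p.
Proof. by apply/negP=> gD; have := top_orth gD gU; rewrite hitsxx. Qed.

Let flipE : q = (greedy PD e (g |: D0) l', greedy PU (fun x y => e y x) U0 l).
Proof.
rewrite /PU /PD /D0 /U0 /q /flip; case: (val p) gU gD => D U /= gU' gD'.
by rewrite inE gU' orbT /= (negPf gD') fillU_greedy fillD_greedy.
Qed.

Let irr : irreflexive e. Proof. by move=> x; apply/negbTE/(edge_irr acy). Qed.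

Let newD_free a b : a \in q.1 -> b \in q.1 -> b \notin g |: D0 -> ~~ e a b.
Proof.
rewrite flipE; apply: greedy_new_free => //.
have /andP[ul lP] := extl'; apply: index_pairwise => // x y exy.
by have /forallP/(_ x)/forallP/(_ y)/implyP/(_ exy) := lP.
Qed.

Let newU_free a b : a \in q.2 -> b \in q.2 -> a \notin U0 -> ~~ e a b.
Proof.
rewrite flipE => aq bq aU0.
apply: (@greedy_new_free _ PU (fun x y => e y x) U0 l b a) => //.
have /andP[ul lP] := extl.
apply: (@index_pairwise _ (fun x y => e y x)) => // x y exy.
by have /forallP/(_ y)/forallP/(_ x)/implyP/(_ exy) := lP.
Qed.

Let newD k : k \in q.1 -> k \notin g |: D0 -> PD k.
Proof. by rewrite flipE => kq /(greedy_new kq)/andP[]. Qed.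

Let newU k : k \in q.2 -> k \notin U0 -> PU k.
Proof. by rewrite {1}flipE => kq /(greedy_new kq)/andP[]. Qed.

Let oldD k : k \in g |: D0 -> k \in q.1.
Proof. rewrite flipE; exact: (subsetP (sub_greedy _ _ _ _)). Qed.

Let oldU k : k \in U0 -> k \in q.2.
Proof. rewrite flipE; exact: (subsetP (sub_greedy _ _ _ _)). Qed.

Lemma flip_mem : g \in q.1. Proof. exact/oldD/setU11. Qed.

(** A vertex that is not above [g] is decided in the first phase, one strictly
    above [g] in the second. *)
Lemma flip_complete : complete e q.
Proof.
apply/completeP=> k.
have [->|kg] := eqVneq k g; first by left; exists g; rewrite ?hitsxx ?flip_mem.
have [ckg|nckg] := boolP (connect e k g).
  have ncgk : ~~ connect e g k.
    by apply: contra kg => cgk; rewrite (connect_antisym acy ckg cgk).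
  have [kq|] := boolP (k \in rpolar q.1); last first.
    by rewrite inE negb_forall_in => /exists_inP[d dq /negPn]; left; exists d.
  right; have [||kU|[s sU eks]] := @greedy_maximal _ PU (fun x y => e y x) U0 l k.
  - by apply: mem_full_tuple; case/andP: extl.
  - by rewrite /PU ncgk.
  - by exists k; rewrite ?hitsxx // flipE.
  by exists s; rewrite ?edge_hits // flipE.
have [kU|] := boolP (k \in lpolar U0); last first.
  rewrite inE negb_forall_in => /exists_inP[u uU /negPn hku].
  by right; exists u; rewrite ?oldU.
left; have [||kD|[s sD esk]] := @greedy_maximal _ PD e (g |: D0) l' k.
- by apply: mem_full_tuple; case/andP: extl'.
- by rewrite /PD nckg.
- by exists k; rewrite ?hitsxx // flipE.
by exists s; rewrite ?edge_hits // flipE.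
Qed.

(** An element of [U] created by the flip is not below [g], so no element of [D]
    that the flip removed points to it. *)
Lemma flip_hop : orthogonal_sets e (Dset p) q.2.
Proof.
apply/orthogonal_setsP=> d u dp uq; have [|/(newU uq)] := boolP (u \in U0).
  by rewrite inE => /andP[up _]; apply: top_orth dp up.
case/andP=> ncgu /rpolarP uD; have [cgd|ncgd] := boolP (connect e g d).
  by apply: contra ncgu => /hits_connect; apply: connect_trans.
by apply/uD/oldD; rewrite !inE dp ncgd orbT.
Qed.

Hypothesis cpl : complete e (val p).

(** A new element of [D] can only fill a gap left by the elements below [g]
    that were removed. *)
Lemma flip_new_below a : a \in q.1 ->
  [\/ a \in Dset p, a = g | [/\ connect e g a, a != g & a \in lpolar U0]].
Proof.
move=> aq; have [/setU1P[->|]|aN] := boolP (a \in g |: D0); first by constructor 2.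
  by rewrite inE => /andP[ap _]; constructor 1.
have /andP[ncag aU0] := newD aq aN; constructor 3.
have ag : a != g by apply: contraNneq aN => ->; rewrite setU11.
split=> //; apply: contraT => ncga.
have [[d dp hda]|[u up hau]] := completeP _ _ cpl a.
  have ncgd : ~~ connect e g d.
    by apply: contra ncga => cgd; apply: connect_trans cgd (hits_connect hda).
  have dD0 : d \in g |: D0 by rewrite !inE dp ncgd orbT.
  have da : d != a by apply: contraNneq aN => <-.
  by have := newD_free (oldD dD0) aq aN; rewrite (hits_neq hda da).
have [cug|ncug] := boolP (connect e u g).
  by rewrite (connect_trans (hits_connect hau) cug) in ncag.
by have := lpolarP aU0 u; rewrite inE up ncug hau => /(_ isT).
Qed.

(** Dually, what the flip adds to [U] lies above [g]. *)
Lemma flip_new_above b : b \in q.2 -> b \notin U0 -> connect e b g.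
Proof.
move=> bq bN; have /andP[ncgb bD] := newU bq bN; apply: contraT => ncbg.
have [[d dp hdb]|[u up hbu]] := completeP _ _ cpl b.
  have ncgd : ~~ connect e g d.
    by apply: contra ncgb => cgd; apply: connect_trans cgd (hits_connect hdb).
  have dD0 : d \in g |: D0 by rewrite !inE dp ncgd orbT.
  by have := rpolarP bD d (oldD dD0); rewrite hdb.
have ncug : ~~ connect e u g.
  by apply: contra ncbg => cug; apply: connect_trans (hits_connect hbu) cug.
have uU0 : u \in U0 by rewrite inE up.
have bu : b != u by apply: contraNneq bN => ->.
by have := newU_free bq (oldU uU0) bN; rewrite (hits_neq hbu bu).
Qed.

Lemma flip_orthogonal : orthogonal_pair e q.1 q.2.
Proof.
apply/orthogonal_pairP; split=> [a b aq bq|a b aq bq|a b aq bq].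
- have [bD|bN] := boolP (b \in g |: D0); last exact: newD_free.
  have [/setU1P[->|]|aN] := boolP (a \in g |: D0).
  + case/setU1P: bD => [->|]; first exact: edge_irr.
    by rewrite inE => /andP[_]; apply: contra; apply: connect1.
  + rewrite inE => /andP[ap _]; case/setU1P: bD => [->|].
      by have := top_orth ap gU; rewrite negb_or => /andP[].
    by rewrite inE => /andP[bp _]; apply: top_indepD bp.
  have /andP[ncag _] := newD aq aN.
  case: (flip_new_below aq) => [ap|ag|[cga _ _]].
  + case/setU1P: bD => [->|]; first by apply: contra ncag; apply: connect1.
    by rewrite inE => /andP[bp _]; apply: top_indepD bp.
  + by rewrite ag setU11 in aN.
  apply/negP=> eab; case/setU1P: bD => [bg|].
    by rewrite bg in eab; rewrite connect1 in ncag.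
  by rewrite inE (connect_trans cga (connect1 eab)) andbF.
- have [aU|aN] := boolP (a \in U0); last exact: newU_free.
  have [bU|bN] := boolP (b \in U0).
    by move: aU bU; rewrite !inE => /andP[ap _] /andP[bp _]; apply: top_indepU bp.
  have cbg := flip_new_above bq bN.
  move: aU; rewrite inE => /andP[_]; apply: contra => eab.
  exact: connect_trans (connect1 eab) cbg.
have [bU|/(newU bq)/andP[_ /rpolarP]] := boolP (b \in U0); last exact.
have [/setU1P[->|]|/(newD aq)/andP[_ /lpolarP]] := boolP (a \in g |: D0);
  last exact.
  move: bU; rewrite inE => /andP[bp ncbg]; rewrite negb_or (top_indepU gU bp) andbT.
  by apply: contraNneq ncbg => <-; apply: connect0.
by move: bU; rewrite !inE => /andP[bp _] /andP[ap _]; apply: top_orth bp.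
Qed.

Lemma flip_is_top : is_top e q.
Proof.
apply: complete_is_top; first exact: acy.
  exact: flip_orthogonal.
exact: flip_complete.
Qed.

End OneFlip.

(** * Hops are chains of flips *)

Lemma flip_upP p q : flip_up p q -> exists g (l l' : #|V|.-tuple V),
  [/\ g \in Uset p, linear_extension e l, reverse_linear_extension e l'
    & val q = flip e l l' g (val p)].
Proof.
case/exists_inP=> g gU /existsP[l /existsP[l' /and3P[lP lP' /eqP qE]]].
by exists g, l, l'.
Qed.

Lemma flip_up_complete p q : flip_up p q -> complete e (val q).
Proof. by case/flip_upP=> g [l [l' [gU lP lP' ->]]]; apply: flip_complete. Qed.

Lemma flip_up_D_nonempty p q : flip_up p q -> Dset q != set0.
Proof.
case/flip_upP=> g [l [l' [gU lP lP' ->]]]; apply/set0Pn; exists g.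
exact: flip_mem.
Qed.

Lemma flip_up_hop p q : flip_up p q -> hop p q.
Proof.
case/flip_upP=> g [l [l' [gU lP lP' qE]]]; rewrite /hop qE; exact: flip_hop.
Qed.

Hypothesis all_complete : forall p : top e, complete e (val p).


Lemma hop_antisym p q : hop p q -> hop q p -> Dset p = Dset q.
Proof.
have upT : upclosed e setT by move=> x y; rewrite inE.
move=> pq qp; have [le_pq eq_pq] := hop_weight acy all_complete upT pq.
have [le_qp _] := hop_weight acy all_complete upT qp.
by move: eq_pq; rewrite eqn_leq le_pq le_qp !setIT => /esym/eqP.
Qed.

Lemma top_eq_U p q : Uset p = Uset q -> p = q.
Proof.
move=> eqU; have eqD : Dset p = Dset q.
  by apply: hop_antisym; [rewrite /hop -eqU | rewrite /hop eqU]; apply: hop_refl.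
by apply: val_inj; apply/eqP; rewrite -pair_eqE; apply/andP; rewrite eqU eqD.
Qed.

(** Otherwise every element of [U p] points into [U q] or belongs to it.  An
    edge from [U p] to some [u'] in [U q] would continue, by completeness of
    [p], to a lower element of [U p]; descending, [U p] is contained in [U q]
    and then equal to it. *)
Lemma hop_witness p q : hop p q -> p != q ->
  exists2 g, g \in Uset p & g \in lpolar (Uset q).
Proof.
move=> /hopP pq npq.
have [/exists_inP//|] := boolP [exists g in Uset p, g \in lpolar (Uset q)].
rewrite negb_exists_in => /forall_inP noU; case/eqP: npq; apply: top_eq_U.
have hitU u' : u' \in Uset q -> exists2 u, u \in Uset p & hits u' u.
  move=> u'q; apply: rpolar_hit => //; apply/rpolarP=> d dp; exact: pq.
have sub u : u \in Uset p -> u \in Uset q.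
  have [n] := ubnP (height e u); elim: n u => // n IH u; rewrite ltnS => le_un up.
  have := noU u up; rewrite inE negb_forall_in => /exists_inP[u' u'q /negPn huu'].
  have [->//|nuu'] := eqVneq u u'; have euu' := hits_neq huu' nuu'.
  have [u2 u2p hu'2] := hitU u' u'q; have [u'2|nu'2] := eqVneq u' u2.
    by have := top_indepU up u2p; rewrite -u'2 euu'.
  have eu'2 := hits_neq hu'2 nu'2.
  have u2q : u2 \in Uset q.
    apply: IH u2p; apply: leq_trans (height_edge acy eu'2) _.
    exact: leq_trans (ltnW (height_edge acy euu')) le_un.
  by have := top_indepU u'q u2q; rewrite eu'2.
apply/setP=> u; apply/idP/idP=> [/sub//|uq].
have [u2 u2p huu2] := hitU u uq; have [->//|nuu2] := eqVneq u u2.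
by have := top_indepU uq (sub _ u2p); rewrite (hits_neq huu2 nuu2).
Qed.

Lemma exists_flip p g : g \in Uset p -> exists p1,
  [/\ flip_up p p1, g \in Dset p1 & forall a, a \in Dset p1 ->
      [\/ a \in Dset p, a = g |
          [/\ connect e g a, a != g &
              a \in lpolar [set k in Uset p | ~~ connect e k g]]]].
Proof.
move=> gp; have [l lP] := exists_linear_extension acy.
have [l' lP'] := exists_reverse_linear_extension acy.
have cplp := all_complete p.
exists (Sub (flip e l l' g (val p)) (flip_is_top gp lP lP' cplp)).
rewrite SubK; split; last by move=> a; apply: flip_new_below.
  apply/exists_inP; exists g => //; apply/existsP; exists l; apply/existsP.
  by exists l'; rewrite lP lP' SubK eqxx.
exact: flip_mem.
Qed.

(** Flipping [p] at a lowest [g] of [U p] that is left polar to [U q] keeps the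
    hop to [q]: by minimality of [g] the part of [U q] below [g] already belongs
    to [U p], so it is orthogonal to what the flip adds to [D p]. *)
Lemma hop_flip_chain p q : hop p q -> connect (@flip_up V e) p q.
Proof.
have upT : upclosed e setT by move=> x y; rewrite inE.
have [n] := ubnP (weight e setT - weight e (Dset p)).
elim: n p => // n IH p lt_pn pq; have [->|npq] := eqVneq p q; first exact: connect0.
have [g0 g0p g0q] := hop_witness pq npq.
have [|g /andP[gp gq] gmin] := arg_minnP
  (P := fun g => (g \in Uset p) && (g \in lpolar (Uset q))) (height e) (i0 := g0).
  by rewrite g0p.
have [p1 [fp1 gp1 newp1]] := exists_flip gp; have pp1 := flip_up_hop fp1.
apply: connect_trans (connect1 fp1) _; apply: IH; last first.
  apply/hopP=> a u ap1 uq; have [ap|->|[cga ag aU]] := newp1 a ap1.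
  - exact: (hopP _ _ pq).
  - exact: (lpolarP gq).
  have low_inU v : v \in Uset q -> connect e g v -> v != g -> v \in Uset p.
    have [k] := ubnP (height e v); elim: k v => // k IHk v; rewrite ltnS => le_vk.
    move=> vq cgv vg.
    have /rpolar_hit[//|v1 v1p hvv1] : v \in rpolar (Dset p).
      by apply/rpolarP=> d dp; apply: (hopP _ _ pq).
    have [->//|nvv1] := eqVneq v v1; have evv1 := hits_neq hvv1 nvv1.
    have v1N : v1 \notin lpolar (Uset q).
      apply/negP=> v1q; have := gmin v1; rewrite v1p v1q leqNgt => /(_ isT)/negP[].
      apply: leq_trans (height_edge acy evv1) (ltnW (height_connect acy cgv _)).
      by rewrite eq_sym.
    move: v1N; rewrite inE negb_forall_in => /exists_inP[v2 v2q /negPn hv12].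
    have [v12|nv12] := eqVneq v1 v2.
      by have := top_indepU vq v2q; rewrite -v12 evv1.
    have ev12 := hits_neq hv12 nv12.
    have lt2v := ltn_trans (height_edge acy ev12) (height_edge acy evv1).
    have cgv2 : connect e g v2.
      exact: connect_trans cgv (connect_trans (connect1 evv1) (connect1 ev12)).
    have v2p : v2 \in Uset p.
      apply: IHk (leq_trans lt2v le_vk) v2q cgv2 _.
      apply: contraTneq lt2v => ->; rewrite -leqNgt ltnW //.
      by apply: (height_connect acy cgv); rewrite eq_sym.
    by have := top_indepU v1p v2p; rewrite ev12.
  apply/negP=> hau; have cgu := connect_trans cga (hits_connect hau).
  have lt_ag : height e a < height e g by apply: height_connect; rewrite // eq_sym.
  have ug : u != g.
    apply: contraTneq lt_ag => <-; rewrite -leqNgt.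
    case/orP: hau => [/eqP->//|/(height_edge acy)/ltnW//].
  have ncug : ~~ connect e u g.
    by apply: contra ug => cug; rewrite (connect_antisym acy cug cgu).
  by have := lpolarP aU u; rewrite inE (low_inU u uq cgu ug) ncug hau => /(_ isT).
have [le_w eq_w] := hop_weight acy all_complete upT pp1; rewrite !setIT in le_w eq_w.
have lt_w : weight e (Dset p) < weight e (Dset p1).
  rewrite ltn_neqAle le_w eq_w andbT; apply: contraTneq gp1 => <-.
  by apply/negP=> gD; have := top_orth gD gp; rewrite hitsxx.
rewrite -ltnS; apply: leq_trans lt_pn; rewrite ltnS; apply: ltn_sub2l (lt_w).
apply: leq_trans lt_w _.
by rewrite [X in _ <= X](big_setID (Dset p1)) /= setTI leq_addr.
Qed.

Lemma top_le_hop : @top_le V e =2 connect (@hop V e).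
Proof.
move=> p q; apply/idP/idP; apply: connect_sub => {}p {}q.
  by move/flip_up_hop/connect1.
exact: hop_flip_chain.
Qed.

End Flips.

(** * The isomorphism with maximal orthogonal pairs *)

Section Isomorphism.
Variables (V : finType) (e : rel V).
Hypothesis acy : acyclic e.
Hypothesis latt : is_lattice (top_le (e := e)).
Implicit Types (p q r : top e).

Local Notation hits := (hits e).
Local Notation lpolar := (lpolar e).
Local Notation rpolar := (rpolar e).
Local Notation Dset p := (val (p : top e)).1.
Local Notation Uset p := (val (p : top e)).2.

(** Tightness alone does not force completeness: in the graph with edges
    from [u1] and [u2] to [k] and from [k] to [d1] and [d2], the pair
    [({d1, d2}, {u1, u2})] is tight.  But the value of a flip is complete and
    has nonempty [D], so the complete top with empty [D] is minimal; in a
    lattice it is the least element, and every other top is the value of a flip. *)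
Lemma lattice_complete p : complete e (val p).
Proof.
have [||||||p0 [cp0 p0D _]] := @exists_top V e acy setT set0 set0 => //.
- by rewrite -setI_eq0 set0I.
- by apply/no_edgeP=> a b; rewrite inE.
- by apply/no_edgeP=> a b; rewrite inE.
- by apply/orthogonal_setsP=> a b; rewrite inE.
rewrite setIT in p0D.
have last_flip q r : top_le q r -> q = r \/ exists r', flip_up r' r.
  case/connectP=> s; case/lastP: s => [|s z]; first by move=> _ /= ->; left.
  by rewrite rcons_path last_rcons => /andP[_ fz] ->; right; exists (last q s).
have [_ [z [zp zp0 _]]] := latt p p0.
have {zp0}zE : z = p0.
  have [//|[r /flip_up_D_nonempty]] := last_flip _ _ zp0.
  by rewrite p0D eqxx.
rewrite {}zE in zp; have [<-//|[r]] := last_flip _ _ zp.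
exact: flip_up_complete.
Qed.

Let cpl := lattice_complete.

Lemma lattice_meets p q : exists r, is_meet (connect (@hop V e)) p q r.
Proof.
have [_ [r [rp rq rmax]]] := latt p q; have leE := top_le_hop acy cpl.
by exists r; split=> [||w wp wq]; rewrite -leE // rmax ?leE.
Qed.

Lemma polars_orthogonal p : orthogonal_sets e (lpolar (Uset p)) (rpolar (Dset p)).
Proof.
apply/orthogonal_setsP=> x y xU yD.
have up0 : upclosed e set0 by move=> a b _; rewrite inE.
apply: (rigid_of_meets acy cpl (D0 := set0) lattice_meets up0) xU yD.
- by rewrite setI0.
- by rewrite inE.
- by rewrite inE.
- by apply/rpolarP=> d; rewrite inE.
Qed.

Lemma polars_mop p : is_mop e (lpolar (Uset p), rpolar (Dset p)).
Proof.
have := polars_orthogonal p; rewrite /is_mop /= => XY.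
apply/andP; split; apply/maxsetP; split=> // A oA sA; apply/eqP.
  rewrite eqEsubset sA andbT; rewrite orthogonal_lpolar in oA.
  apply/(subset_trans oA)/subsetP=> x /lpolarP xY; apply/lpolarP=> u up.
  exact/xY/U_sub_rpolar.
rewrite eqEsubset sA andbT; rewrite orthogonal_rpolar in oA.
apply/(subset_trans oA)/subsetP=> y /rpolarP yX; apply/rpolarP=> d dp.
exact/yX/D_sub_lpolar.
Qed.

Definition mop_of_top p : mop e :=
  Sub (lpolar (Uset p), rpolar (Dset p)) (polars_mop p).

Lemma le_lpolar p q : top_le p q = (lpolar (Uset p) \subset lpolar (Uset q)).
Proof.
rewrite (top_le_hop acy cpl); apply/idP/idP=> [pq|/subsetP spq]; last first.
  by apply/connect1/hopP=> d u dp; apply/lpolarP/spq/D_sub_lpolar.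
have {pq} [s] := connectP pq; elim: s p => [|p1 s IH] p /=; first by move=> _ ->.
case/andP=> /hopP pp1 pth lst; apply: subset_trans (IH p1 pth lst).
apply/subsetP=> x xp; apply/lpolarP=> u up1.
apply: (orthogonal_setsP _ _ _ (polars_orthogonal p)) xp _.
by apply/rpolarP=> d dp; apply: pp1.
Qed.

Lemma le_rpolar p q : top_le p q -> rpolar (Dset q) \subset rpolar (Dset p).
Proof.
rewrite le_lpolar => /subsetP spq; apply/subsetP=> y yq; apply/rpolarP=> d dp.
apply: (orthogonal_setsP _ _ _ (polars_orthogonal q)) _ yq.
exact/spq/D_sub_lpolar.
Qed.

Lemma mop_of_top_mono : {mono mop_of_top : p q / top_le p q >-> mop_le p q}.
Proof. by move=> p q; rewrite /mop_le !SubK le_lpolar. Qed.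

Lemma mop_of_top_inj : injective mop_of_top.
Proof.
move=> p q /(congr1 val); rewrite !SubK => -[XE _].
have [//|npq] := eqVneq p q; have pq : hop p q.
  by apply/hopP=> d u dp; apply/lpolarP; rewrite -XE; apply: D_sub_lpolar.
have [g gp] := hop_witness acy cpl pq npq; rewrite -XE => /lpolarP/(_ g gp).
by rewrite hitsxx.
Qed.

Lemma exists_top_U U0 : no_edge e U0 U0 -> exists p, Uset p = U0.
Proof.
move=> iU0; have [|||||u _|p [_ pU]] := @exists_top_slice V e acy set0 set0 U0 => //.
- by move=> a b _; rewrite inE.
- by apply/no_edgeP=> a b; rewrite inE.
- by move=> u _; rewrite inE.
- by apply/rpolarP=> d; rewrite inE.
by exists p; rewrite -pU setD0.
Qed.

Lemma exists_finite_meet (s : seq (top e)) : exists z,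
  {in s, forall p, top_le z p} /\
  forall w, {in s, forall p, top_le w p} -> top_le w z.
Proof.
elim: s => [|p s [z [zs zmax]]].
  have [|z zU] := @exists_top_U set0; first by apply/no_edgeP=> a b; rewrite inE.
  exists z; split=> // w _; rewrite (top_le_hop acy cpl); apply/connect1/hopP.
  by move=> d u _; rewrite zU inE.
have [_ [z' [z'p z'z z'max]]] := latt p z; exists z'; split=> [q|w ws].
  by rewrite inE => /orP[/eqP->//|/zs]; apply: connect_trans.
apply: z'max; first by apply: ws; rewrite mem_head.
by apply: zmax => q qs; apply: ws; rewrite inE qs orbT.
Qed.

(** The pair [(X, Y)] comes from the meet of the tops with [U = {y}] for [y]
    in [Y]: these all lie above the tops with [D = {x}] for [x] in [X]. *)
Lemma mop_of_top_surj (m : mop e) : exists p, mop_of_top p == m.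
Proof.
case: m => -[X Y] mopXY.
have /andP[/maxsetP/=[oXY maxX] /maxsetP/=[_ maxY]] := mopXY.
pose s := enum [pred p : top e | [exists y in Y, Uset p == [set y]]].
have [z [zs zmax]] := exists_finite_meet s; exists z.
have sY : Y \subset rpolar (Dset z).
  apply/subsetP=> y yY; have [|p pU] := @exists_top_U [set y].
    by apply/no_edgeP=> a b /set1P-> /set1P->; apply: edge_irr.
  have /zs/le_rpolar/subsetP : p \in s.
    by rewrite mem_enum inE; apply/exists_inP; exists y => //; apply/eqP.
  by apply; apply: U_sub_rpolar; rewrite pU set11.
have sX : X \subset lpolar (Uset z).
  apply/subsetP=> x xX; have [|p pD] := @exists_top_D V e acy [set x].
    by apply/no_edgeP=> a b /set1P-> /set1P->; apply: edge_irr.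
  have : top_le p z.
    apply: zmax => q; rewrite mem_enum inE => /exists_inP[y yY /eqP qU].
    rewrite (top_le_hop acy cpl); apply/connect1/hopP=> d u.
    rewrite pD qU => /set1P-> /set1P->; exact: (orthogonal_setsP _ _ _ oXY).
  rewrite le_lpolar => /subsetP; apply.
  by apply: D_sub_lpolar; rewrite pD set11.
have /orthogonal_setsP oz := polars_orthogonal z.
apply/eqP/val_inj; rewrite SubK /=; congr (_, _).
  by apply: maxX => //; apply/orthogonal_setsP=> x y xz /(subsetP sY); apply: oz.
by apply: maxY => //; apply/orthogonal_setsP=> x y /(subsetP sX) xz; apply: oz.
Qed.

Lemma mop_of_top_bij : bijective mop_of_top.
Proof.
exists (fun m => xchoose (mop_of_top_surj m)) => [p|m].
  exact/mop_of_top_inj/eqP/(xchooseP (mop_of_top_surj _)).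
exact/eqP/(xchooseP (mop_of_top_surj _)).
Qed.

End Isomorphism.

Theorem corollary4p7 (V : finType) (e : rel V) :
  acyclic e ->
  is_lattice (top_le (e := e)) ->
  order_isomorphic (top_le (e := e)) (mop_le (e := e)).
Proof.
move=> acy latt; exists (mop_of_top acy latt).
by split; [apply: mop_of_top_bij | apply: mop_of_top_mono].
Qed.
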